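(* There is an absolute constant $c>0$ such that the following holds. Let $M=(\mathcal{S},\mathcal{A},P,r,\gamma)$ be a discounted MDP whose transition kernel admits a linear feature representation $\phi:\mathcal{S}\times\mathcal{A}\to\mathbb{R}^K$ and which satisfies the anchor-state assumption with anchor set $\mathcal{K}=\{(s_1,a_1),\dots,(s_K,a_K)\}$ and convex coefficients $\lambda_k^{s,a}$. Let $\delta\in(0,1)$, $\epsilon\in(0,(1-\gamma)^{-1/2}]$ and $\epsilon_{\mathrm{PS}}\ge 0$. Let $\widehat{M}$ be the empirical MDP built from $N$ samples per anchor pair, and let $\widehat{\pi}$ be an $\epsilon_{\mathrm{PS}}$-optimal policy in $\widehat{M}$. If $$N\ \ge\ \frac{c\log\big(cK(1-\gamma)^{-1}\delta^{-1}\big)}{(1-\gamma)^3\epsilon^2},$$ then with probability larger than $1-\delta$, $$Q^{\widehat{\pi}}(s,a)\ \ge\ Q^*(s,a)-\epsilon-\frac{3\epsilon_{\mathrm{PS}}}{1-\gamma}\qquad\text{for all }(s,a)\in\mathcal{S}\times\mathcal{A}.$$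
   Context: A discounted MDP $M=(\mathcal{S},\mathcal{A},P,r,\gamma)$ has finite state space $\mathcal{S}$, finite action space $\mathcal{A}$, transition distributions $P(\cdot|s,a)$ on $\mathcal{S}$, reward $r:\mathcal{S}\times\mathcal{A}\to[0,1]$ and discount $\gamma\in(0,1)$. A policy is a map $\pi:\mathcal{S}\to\mathcal{A}$. Its value function is $V^\pi(s)=\mathbb{E}[\sum_{t\ge0}\gamma^t r(s^t,\pi(s^t))\mid s^0=s]$ and its Q-function is $Q^\pi(s,a)=r(s,a)+\gamma\sum_{s'}P(s'|s,a)V^\pi(s')$. $V^*(s)=\max_\pi V^\pi(s)$, attained simultaneously at all states by an optimal policy $\pi^*$, and $Q^*=Q^{\pi^*}$. Linear feature representation: $P(s'|s,a)=\sum_{k=1}^K\phi_k(s,a)\psi_k(s')$ for all $s,a,s'$, for some unknown functions $\psi_1,\dots,\psi_K:\mathcal{S}\to\mathbb{R}$. Anchor-state assumption: there is a set $\mathcal{K}=\{(s_k,a_k)\}_{k=1}^K\subset\mathcal{S}\times\mathcal{A}$ and coefficients $\lambda_k^{s,a}\ge0$ with $\sum_k\lambda_k^{s,a}=1$ and $\phi(s,a)=\sum_k\lambda_k^{s,a}\phi(s_k,a_k)$ for every $(s,a)$. Empirical MDP: using a generative model, for each $k$ draw $N$ i.i.d. samples from $P(\cdot|s_k,a_k)$ (independently across $k$); set $\widehat{P}_\mathcal{K}(s'|s_k,a_k)=\mathrm{count}(s_k,a_k,s')/N$, where the count is the number of samples equal to $s'$; set $\widehat{P}(s'|s,a)=\sum_k\lambda_k^{s,a}\widehat{P}_\mathcal{K}(s'|s_k,a_k)$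 (a probability kernel under the anchor assumption) and $\widehat{M}=(\mathcal{S},\mathcal{A},\widehat{P},r,\gamma)$. Quantities of $\widehat{M}$ carry hats ($\widehat{V}^\pi,\widehat{Q}^\pi,\widehat{V}^*$). A policy $\widehat{\pi}$ is $\epsilon_{\mathrm{PS}}$-optimal in $\widehat{M}$ if $\widehat{V}^{\widehat{\pi}}(s)\ge\widehat{V}^*(s)-\epsilon_{\mathrm{PS}}$ for all $s$; it may depend on the samples. *)

(* Defs.v *)
From HB Require Import structures.
From mathcomp Require Import all_boot all_order all_algebra.
From mathcomp Require Import all_classical all_reals all_analysis.
From mathcomp Require Import Rstruct Rstruct_topology.
Set Implicit Arguments. Unset Strict Implicit. Unset Printing Implicit Defensive.
Import Order.TTheory GRing.Theory Num.Theory.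
Local Open Scope ring_scope.

Section MDP.
Variables (R : realType) (S A : finType).

Definition is_kernel (P : S -> A -> S -> R) : Prop :=
  (forall s a s', 0 <= P s a s') /\ (forall s a, \sum_(s' : S) P s a s' = 1).

Fixpoint dist (P : S -> A -> S -> R) (pi : {ffun S -> A}) (t : nat) (s s' : S) : R :=
  match t with
  | 0 => (s' == s)%:R
  | t'.+1 => \sum_(s'' : S) dist P pi t' s s'' * P s'' (pi s'') s'
  end.

(* V^pi(s) = E[ sum_{t>=0} g^t r(s^t, pi(s^t)) | s^0 = s ]
          = sum_{t>=0} g^t E[r(s^t, pi(s^t))] *)
Definition Vpi (P : S -> A -> S -> R) (r : S -> A -> R) (g : R)
  (pi : {ffun S -> A}) (s : S) : R :=
  \big[+%R/0]_(0 <= t <oo) (g ^+ t * \sum_(s' : S) dist P pi t s s' * r s' (pi s')).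

Definition Qpi (P : S -> A -> S -> R) (r : S -> A -> R) (g : R)
  (pi : {ffun S -> A}) (s : S) (a : A) : R :=
  r s a + g * \sum_(s' : S) P s a s' * Vpi P r g pi s'.

(* V*(s) = max over (deterministic) policies of V^pi(s); values are >= 0
   since rewards are nonnegative, so 0 is a harmless neutral element. *)
Definition Vstar (P : S -> A -> S -> R) (r : S -> A -> R) (g : R) (s : S) : R :=
  \big[Num.max/0]_(pi : {ffun S -> A}) Vpi P r g pi s.

(* Q* = Q^{pi*}, with V^{pi*} = V*. *)
Definition Qstar (P : S -> A -> S -> R) (r : S -> A -> R) (g : R) (s : S) (a : A) : R :=
  r s a + g * \sum_(s' : S) P s a s' * Vstar P r g s'.

Definition linear_rep (K : nat) (P : S -> A -> S -> R) (phi : S -> A -> 'I_K -> R) : Prop :=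
  exists psi : 'I_K -> S -> R,
    forall s a s', P s a s' = \sum_(k < K) phi s a k * psi k s'.

Definition anchor (K : nat) (phi : S -> A -> 'I_K -> R)
  (sk : 'I_K -> S) (ak : 'I_K -> A) (lam : S -> A -> 'I_K -> R) : Prop :=
  (forall s a k, 0 <= lam s a k) /\ (forall s a, \sum_(k < K) lam s a k = 1) /\
  (forall s a i, phi s a i = \sum_(k < K) lam s a k * phi (sk k) (ak k) i).

Definition outcome (K N : nat) := {ffun 'I_K -> {ffun 'I_N -> S}}.

Definition prob_outcome (K N : nat) (P : S -> A -> S -> R)
  (sk : 'I_K -> S) (ak : 'I_K -> A) (w : outcome K N) : R :=
  \prod_(k < K) \prod_(j < N) P (sk k) (ak k) (w k j).

Definition prob_event (K N : nat) (P : S -> A -> S -> R)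
  (sk : 'I_K -> S) (ak : 'I_K -> A) (E : pred (outcome K N)) : R :=
  \sum_(w : outcome K N | E w) prob_outcome P sk ak w.

Definition PhatK (K N : nat) (w : outcome K N) (k : 'I_K) (s' : S) : R :=
  (#|[pred j : 'I_N | w k j == s']|)%:R / N%:R.

Definition Phat (K N : nat) (lam : S -> A -> 'I_K -> R) (w : outcome K N)
  (s : S) (a : A) (s' : S) : R :=
  \sum_(k < K) lam s a k * PhatK w k s'.

End MDP.

(* Main.v *)
(* Let H = 1/(1-g). For a function f independent of the samples of the anchor pair k, Bernstein's
   inequality with a fixed parameter bounds (Phat_k - P_k) f by x Var_{P_k}(f) + O(log(..)/(N x)),
   with x of order eps (1-g)^2. Under the anchor assumption P(.|s,a) = sum_k lam_k P_k, and
   concavity of the variance turns the K anchor bounds into bounds at every (s,a).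
   Since g (P V)^2 >= (g P V)^2 = (V - r)^2, one has g Var_P(V) <= g P V^2 - V^2 + 2 V, so adding
   a multiple of V^2 to the error of a policy makes the variance term telescope in the maximum
   principle, and the accumulated error is O(x H^2) instead of the naive O(x H^3).
   At the optimal policy of M this is applied with the deterministic test function V + x V^2, which
   replaces the variance under P by the one under Phat. At pihat the value function
   Vhat^* depends on the samples of every k; it is the value of the MDP obtained by
   dropping the row k and paying the reward u = g Phat_k Vhat^* instead, so a union bound over a
   grid of values of u suffices. The grid is centred at g P_k V^* with radius 2 eps H: its
   number of points is O(H^3), independent of eps. *)
Require Import Defs.
From HB Require Import structures.
From mathcomp Require Import all_boot all_order all_algebra.
From mathcomp Require Import all_classical all_reals all_analysis.
From mathcomp Require Import Rstruct Rstruct_topology.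
From mathcomp Require Import ring lra.
Import Order.TTheory GRing.Theory Num.Theory.
Import numFieldNormedType.Exports.
Set Implicit Arguments. Unset Strict Implicit. Unset Printing Implicit Defensive.
Local Open Scope ring_scope.

(** * Means and variances on a finite type *)

Section FiniteMean.
Variables (R : realType) (T : finType).
Implicit Types (p f g : T -> R) (c : R).

Definition is_dist p : Prop := (forall t, 0 <= p t) /\ \sum_t p t = 1.

Definition mean p f : R := \sum_t p t * f t.

Definition fvar p f : R := mean p (fun t => f t ^+ 2) - mean p f ^+ 2.

Lemma mean_ext p f g : (forall t, f t = g t) -> mean p f = mean p g.
Proof. by move=> fg; apply: eq_bigr => t _; rewrite fg. Qed.

Lemma meanD p f g : mean p (fun t => f t + g t) = mean p f + mean p g.
Proof. by rewrite /mean -big_split; apply: eq_bigr => t _; rewrite mulrDr. Qed.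

Lemma meanZ p f c : mean p (fun t => c * f t) = c * mean p f.
Proof. by rewrite /mean mulr_sumr; apply: eq_bigr => t _; rewrite mulrCA. Qed.

Lemma meanN p f : mean p (fun t => - f t) = - mean p f.
Proof. by rewrite /mean -sumrN; apply: eq_bigr => t _; rewrite mulrN. Qed.

Lemma meanB p f g : mean p (fun t => f t - g t) = mean p f - mean p g.
Proof. by rewrite meanD meanN. Qed.

Section Dist.
Variable p : T -> R.
Hypothesis p_dist : is_dist p.

Lemma mean_cst c : mean p (fun=> c) = c.
Proof. by rewrite /mean -mulr_suml p_dist.2 mul1r. Qed.

Lemma ler_mean f g : (forall t, f t <= g t) -> mean p f <= mean p g.
Proof. by move=> fg; apply: ler_sum => t _; apply: ler_wpM2l; rewrite ?p_dist.1. Qed.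

Lemma mean_le f c : (forall t, f t <= c) -> mean p f <= c.
Proof. by move=> fc; rewrite -[leRHS]mean_cst; apply: ler_mean. Qed.

Lemma mean_ge f c : (forall t, c <= f t) -> c <= mean p f.
Proof. by move=> fc; rewrite -[leLHS]mean_cst; apply: ler_mean. Qed.

Lemma mean_norm_le f c : (forall t, `|f t| <= c) -> `|mean p f| <= c.
Proof.
move=> fc; rewrite ler_norml mean_ge ?mean_le // => t;
  by have := fc t; rewrite ler_norml => /andP[].
Qed.

Lemma mean_sqrB f c : mean p (fun t => (f t - c) ^+ 2) = fvar p f + (mean p f - c) ^+ 2.
Proof.
rewrite (@mean_ext _ _ (fun t => f t ^+ 2 + (- (c *+ 2) * f t + c ^+ 2))).
  by rewrite meanD meanD meanZ mean_cst /fvar; ring.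
by move=> t; ring.
Qed.

Lemma fvar_ge0 f : 0 <= fvar p f.
Proof.
have := mean_sqrB f (mean p f); rewrite subrr expr0n addr0 => <-.
by apply: mean_ge => t; exact: sqr_ge0.
Qed.

Lemma fvar_le_mean_sqr f c : fvar p f <= mean p (fun t => (f t - c) ^+ 2).
Proof. by rewrite mean_sqrB lerDl sqr_ge0. Qed.

Lemma fvar_mean f : fvar p f = mean p (fun t => (f t - mean p f) ^+ 2).
Proof. by rewrite mean_sqrB subrr expr0n addr0. Qed.

Lemma sqr_mean_le f : mean p f ^+ 2 <= mean p (fun t => f t ^+ 2).
Proof. by rewrite -subr_ge0 fvar_ge0. Qed.

Lemma fvar_le_sqr f c : (forall t, `|f t| <= c) -> fvar p f <= c ^+ 2.
Proof.
move=> fc; apply: le_trans (fvar_le_mean_sqr f 0) _.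
apply: mean_le => t; rewrite subr0 -[leLHS]real_normK ?num_real //.
by rewrite ler_sqr ?nnegrE ?fc // (le_trans _ (fc t)).
Qed.

Lemma fvarN f : fvar p (fun t => - f t) = fvar p f.
Proof.
rewrite /fvar meanN sqrrN; congr (_ - _).
by apply: mean_ext => t; rewrite sqrrN.
Qed.

Lemma fvar_perturb f g c : (forall t, `|f t - g t| <= c) ->
  fvar p f <= 2 * fvar p g + 2 * c ^+ 2.
Proof.
move=> fg; apply: le_trans (fvar_le_mean_sqr f (mean p g)) _.
have -> : 2 * fvar p g + 2 * c ^+ 2 =
    mean p (fun t => 2 * (g t - mean p g) ^+ 2 + 2 * c ^+ 2).
  by rewrite meanD mean_cst meanZ -fvar_mean.
apply: ler_mean => t.
have : (f t - g t) ^+ 2 <= c ^+ 2.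
  rewrite -[leLHS]real_normK ?num_real //.
  by rewrite ler_sqr ?nnegrE ?fg // (le_trans _ (fg t)).
have := sqr_ge0 (f t - g t - (g t - mean p g)); nra.
Qed.

(** On [[0, H]] the map [z + x * z ^+ 2] is 2-Lipschitz, since [x * (f t + m) <= 1]; squaring gives
    the factor 4. *)
Lemma fvar_add_sqr f (x H : R) : (forall t, 0 <= f t <= H) -> 0 <= x -> 2 * x * H <= 1 ->
  fvar p (fun t => f t + x * f t ^+ 2) <= 4 * fvar p f.
Proof.
move=> fH x0 xH; set m := mean p f.
apply: le_trans (fvar_le_mean_sqr _ (m + x * m ^+ 2)) _.
rewrite (fvar_mean f) -meanZ; apply: ler_mean => t.
have m0 : 0 <= m by apply: mean_ge => s; have /andP[] := fH s.
have mH : m <= H by apply: mean_le => s; have /andP[] := fH s.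
have /andP[f0 fH'] := fH t.
have -> : f t + x * f t ^+ 2 - (m + x * m ^+ 2) = (f t - m) * (1 + x * (f t + m)) by ring.
rewrite exprMn mulrC; apply: ler_wpM2r; first exact: sqr_ge0.
have : 0 <= x * (f t + m) <= 1.
  by apply/andP; split; [apply: mulr_ge0 => //; lra | nra].
by move: (x * _) => z /andP[z0 z1]; nra.
Qed.


End Dist.

(** At a maximizer of [f] the hypothesis reads [max <= b + g * max]. No linear operator is involved,
    so this also applies to optimal values. *)
Lemma contraction_bound (g b : R) f : 0 < g < 1 ->
  (forall m, (forall t, f t <= m) -> forall t, f t <= b + g * m) -> forall t, f t <= b / (1 - g).
Proof.
move=> /andP[g0 g1] fb t.
case: (@arg_maxP _ _ _ t xpredT f isT) => t0 _ tmax.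
apply: le_trans (tmax t isT) _; rewrite ler_pdivlMr ?subr_gt0 //.
have := fb (f t0) (fun s => tmax s isT) t0; lra.
Qed.

Lemma max_principle (g b : R) (Q : T -> T -> R) f :
  (forall t, is_dist (Q t)) -> 0 < g < 1 ->
  (forall t, f t <= b + g * mean (Q t) f) -> forall t, f t <= b / (1 - g).
Proof.
move=> Qd g01 fb; apply: contraction_bound => // m fm t.
apply: le_trans (fb t) _; rewrite lerD2l ler_pM2l ?(andP g01).1 //.
exact: (mean_le (Qd t)).
Qed.

End FiniteMean.

(** * Concentration of the empirical anchor kernel *)

Section Concentration.
Variables (R : realType) (S A : finType) (K N : nat).
Variables (P : S -> A -> S -> R) (sk : 'I_K -> S) (ak : 'I_K -> A).
Hypothesis kerP : is_kernel P.
Let Pk k := P (sk k) (ak k).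

Lemma kernel_dist s a : is_dist (P s a).
Proof. by case: kerP => P0 P1; split. Qed.

(** As [expR (- u) >= 1 - u], it suffices to compare after multiplying by [1 - u], where the right
    side becomes [1 + u ^+ 2 * (1 - 2 * u)]. *)
Lemma expR_le_quadratic (u : R) : u <= 2^-1 -> expR u <= 1 + u + 2 * u ^+ 2.
Proof.
move=> u2; have e := expR_ge1Dx (- u).
have : expR u * expR (- u) = 1 by rewrite -exp.expRD subrr exp.expR0.
have := expR_gt0 u; move: (expR u) (expR (- u)) e => a b ab a0 ab1.
suff : a * (1 - u) <= (1 + u + 2 * u ^+ 2) * (1 - u) by rewrite ler_pM2r //; lra.
apply: (@le_trans _ _ 1); first by rewrite -ab1; nra.
rewrite -subr_ge0 [X in _ <= X](_ : _ = u ^+ 2 * (1 - 2 * u)); last by ring.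
by apply: mulr_ge0; [exact: sqr_ge0 | lra].
Qed.

Lemma mgf_le (T : finType) (p f : T -> R) (B x : R) :
  is_dist p -> (forall t, `|f t| <= B) -> 0 < x -> x * B <= 4^-1 ->
  mean p (fun t => expR (x * (f t - mean p f))) <= expR (2 * x ^+ 2 * fvar p f).
Proof.
move=> pd fB x0 xB.
apply: (@le_trans _ _ (1 + 2 * x ^+ 2 * fvar p f)); last exact: expR_ge1Dx.
have -> : 1 + 2 * x ^+ 2 * fvar p f = mean p (fun t =>
    1 + (x * f t - x * mean p f) + 2 * x ^+ 2 * (f t - mean p f) ^+ 2).
  rewrite !(meanD, meanB, meanZ) !(mean_cst pd) -(fvar_mean pd); ring.
apply: (ler_mean pd) => t.
have -> : 1 + (x * f t - x * mean p f) + 2 * x ^+ 2 * (f t - mean p f) ^+ 2 =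
   1 + (x * (f t - mean p f)) + 2 * (x * (f t - mean p f)) ^+ 2 by ring.
apply: expR_le_quadratic.
have /ler_normlP[_ h1] := fB t; have /ler_normlP[h2 _] := mean_norm_le pd fB.
nra.
Qed.

Definition sample_prob (p : S -> R) (v : {ffun 'I_N -> S}) : R := \prod_j p (v j).

Lemma sum_sample_prob p : is_dist p -> \sum_v sample_prob p v = 1.
Proof.
move=> [_ p1]; rewrite /sample_prob -(bigA_distr_bigA (fun=> p)).
by rewrite big1.
Qed.

Definition resample (w : outcome S K N) (k : 'I_K) (v : {ffun 'I_N -> S}) : outcome S K N :=
  [ffun i => if i == k then v else w i].

Lemma prob_outcomeE w : prob_outcome P sk ak w = \prod_k sample_prob (Pk k) (w k).
Proof. by []. Qed.

Lemma prob_outcome_ge0 (w : outcome S K N) : 0 <= prob_outcome P sk ak w.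
Proof. by apply: prodr_ge0 => k _; apply: prodr_ge0 => j _; exact: kerP.1. Qed.

Lemma sum_prob_outcome : \sum_(w : outcome S K N) prob_outcome P sk ak w = 1.
Proof.
rewrite /prob_outcome -(bigA_distr_bigA (fun k => sample_prob (Pk k))) big1 // => k _.
exact: sum_sample_prob (kernel_dist _ _).
Qed.

(* The pair (w, v) has the same law as (resample w k v, w k). *)
Lemma sum_resample k (F : outcome S K N -> R) :
  \sum_w prob_outcome P sk ak w * F w =
  \sum_w prob_outcome P sk ak w * \sum_v sample_prob (Pk k) v * F (resample w k v).
Proof.
transitivity (\sum_(q : outcome S K N * {ffun 'I_N -> S})
    prob_outcome P sk ak q.1 * sample_prob (Pk k) q.2 * F q.1).
  rewrite -(pair_bigA _ (fun w v => prob_outcome P sk ak w * sample_prob (Pk k) v * F w)) /=.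
  apply: eq_bigr => w _; rewrite -mulr_suml -mulr_sumr sum_sample_prob ?mulr1 //.
  exact: kernel_dist.
pose swap (q : outcome S K N * {ffun 'I_N -> S}) := (resample q.1 k q.2, q.1 k).
have swapK : involutive swap.
  move=> [w v]; rewrite /swap /=; congr (_, _).
    by apply/ffunP => i; rewrite !ffunE; case: eqP => // ->.
  by rewrite ffunE eqxx.
rewrite (reindex_inj (inv_inj swapK)) /=.
under [RHS]eq_bigr do rewrite mulr_sumr.
rewrite [RHS]pair_bigA /=; apply: eq_bigr => -[w v] _ /=.
rewrite mulrA; congr (_ * _); rewrite !prob_outcomeE.
rewrite (bigD1 k) // [in RHS](bigD1 k) //= ffunE eqxx.
have -> : \prod_(i | i != k) sample_prob (Pk i) (resample w k v i) =
          \prod_(i | i != k) sample_prob (Pk i) (w i).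
  by apply: eq_bigr => i /negPf ik; rewrite ffunE ik.
ring.
Qed.

Lemma mean_PhatK (w : outcome S K N) k (f : S -> R) :
  mean (PhatK R w k) f = (\sum_j f (w k j)) / N%:R.
Proof.
rewrite /mean /PhatK; under eq_bigr do rewrite mulrAC.
rewrite -mulr_suml; congr (_ / _).
rewrite (partition_big (w k) xpredT) //=; apply: eq_bigr => s _.
rewrite (eq_bigr (fun=> f s)); last by move=> j /eqP ->.
by rewrite sumr_const mulr_natl.
Qed.

Lemma resample_id (w : outcome S K N) k v : resample w k v k = v.
Proof. by rewrite ffunE eqxx. Qed.

Section Tail.
Variables (k : 'I_K) (f : outcome S K N -> S -> R) (B x L : R).
Hypothesis N0 : (0 < N)%N.
Hypothesis f_resample : forall w v, f (resample w k v) = f w.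
Hypothesis f_bound : forall w s, `|f w s| <= B.
Hypothesis x0 : 0 < x.
Hypothesis xB : x * B <= 4^-1.

(** The parameter [x] is fixed in advance instead of being optimized for each variance. The bound is
    then affine in [fvar], so it passes to mixtures and can telescope. *)
Definition deviates w : bool :=
  mean (Pk k) (f w) + 2 * x * fvar (Pk k) (f w) + L / (N%:R * x) < mean (PhatK R w k) (f w).

(** Chernoff bound for a random [f]: [G] is at least 1 where [deviates] holds. By [f_resample],
    [f w] does not see the row [k]; once that row is resampled, the sum over [v] factors into [N]
    moment generating functions with the rest of [w] held fixed. *)
Lemma bernstein_tail : prob_event P sk ak deviates <= expR (- L).
Proof.
pose G w := expR (\sum_j x * (f w (w k j) - mean (Pk k) (f w))) *
            expR (- (N%:R * (2 * x ^+ 2 * fvar (Pk k) (f w)) + L)).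
apply: (@le_trans _ _ (\sum_w prob_outcome P sk ak w * G w)).
  rewrite /prob_event big_mkcond /=; apply: ler_sum => w _.
  have G0 : 0 <= G w by apply: mulr_ge0; exact: expR_ge0.
  case: ifP => [dev|_]; last exact: mulr_ge0 (prob_outcome_ge0 _) G0.
  rewrite -[leLHS]mulr1; apply: ler_wpM2l; first exact: prob_outcome_ge0.
  rewrite /G -exp.expRD; apply: le_trans (expR_ge1Dx _); rewrite lerDl.
  rewrite -mulr_sumr sumrB sumr_const card_ord -[_ *+ N]mulr_natl.
  move: dev; rewrite /deviates mean_PhatK.
  set s := \sum_j _; set m := mean _ _; set V := fvar _ _ => dev.
  have n0 : (0 : R) < N%:R by rewrite ltr0n.
  move: dev; rewrite ltr_pdivlMr // => dev.
  have e : (L / (N%:R * x)) * N%:R * x = L by field; rewrite !gt_eqF.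
  have := ltW dev; rewrite -(ler_pM2l x0); move: (L / _) e => l e; nra.
rewrite (sum_resample k) -[leRHS]mul1r -sum_prob_outcome mulr_suml.
apply: ler_sum => w _; apply: ler_wpM2l; first exact: prob_outcome_ge0.
rewrite /G; under eq_bigr do rewrite !resample_id f_resample mulrA.
rewrite -mulr_suml.
have -> : - (N%:R * (2 * x ^+ 2 * fvar (Pk k) (f w)) + L) =
  - (N%:R * (2 * x ^+ 2 * fvar (Pk k) (f w))) - L by ring.
rewrite exp.expRD mulrA -[leRHS]mul1r ler_pM2r ?expR_gt0 //.
rewrite expRN ler_pdivrMr ?expR_gt0 // mul1r.
under eq_bigr do rewrite expR_sum -big_split /=.
rewrite -(bigA_distr_bigA (fun _ s => Pk k s * expR (x * (f w s - mean (Pk k) (f w))))) /=.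
rewrite prodr_const card_ord exp.expRM_natl; apply: lerXn2r; rewrite ?nnegrE ?expR_ge0 //.
  by apply: sumr_ge0 => s _; apply: mulr_ge0; [exact: kerP.1 | exact: expR_ge0].
exact: (mgf_le (kernel_dist _ _) (f_bound w)).
Qed.

End Tail.

Lemma bernstein_uniform (J : finType) (F : 'I_K -> J -> outcome S K N -> S -> R)
    (B x L d : R) (E : pred (outcome S K N)) :
  (0 < N)%N -> (forall k j w v, F k j (resample w k v) = F k j w) ->
  (forall k j w s, `|F k j w s| <= B) -> 0 < x -> x * B <= 4^-1 ->
  K%:R * #|J|%:R * expR (- L) < d ->
  (forall w, (forall k j, mean (PhatK R w k) (F k j w) <=
     mean (Pk k) (F k j w) + 2 * x * fvar (Pk k) (F k j w) + L / (N%:R * x)) -> E w) ->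
  1 - d < prob_event P sk ak E.
Proof.
move=> N0 Fres FB x0 xB Ld good.
have tail k j := bernstein_tail L N0 (Fres k j) (FB k j) x0 xB.
rewrite ltrBlDr; apply: le_lt_trans (_ : _ <= prob_event P sk ak E +
   \sum_k \sum_j prob_event P sk ak (deviates k (F k j) x L)) _.
  rewrite -[leLHS]sum_prob_outcome /prob_event (bigID E) /=; apply: lerD => //.
  under [leRHS]eq_bigr do under eq_bigr do rewrite big_mkcond.
  under [leRHS]eq_bigr do rewrite exchange_big.
  rewrite exchange_big big_mkcond /=; apply: ler_sum => w _.
  have pos k j : 0 <= (if deviates k (F k j) x L w then prob_outcome P sk ak w else 0).
    by case: ifP => // _; exact: prob_outcome_ge0.
  case: ifPn => [nE|_]; last by apply: sumr_ge0 => k _; apply: sumr_ge0.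
  case: (pselect (exists k j, deviates k (F k j) x L w)) => [[k [j dev]]|ndev].
    rewrite (bigD1 k) // (bigD1 j) //= dev -addrA lerDl.
    by apply: addr_ge0; [|apply: sumr_ge0 => i _]; apply: sumr_ge0.
  exfalso; move/negP: nE; apply; apply: good => k j.
  by rewrite leNgt; apply/negP => dev; apply: ndev; exists k, j.
rewrite ltrD2l; apply: le_lt_trans Ld.
apply: (@le_trans _ _ (\sum_(k < K) \sum_(j : J) expR (- L))).
  by apply: ler_sum => k _; apply: ler_sum => j _; exact: tail.
rewrite !sumr_const -mulrnA -[X in X <= _]mulr_natl natrM [X in X * _]mulrC.
by have -> : #|xpredT : pred 'I_K| = K by exact: card_ord.
Qed.

End Concentration.

(** * Bellman equations *)

Section BigMax.
Variables (R : realType) (T : finType).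
Implicit Types f h : T -> R.

(** The default 0 is common to both maxima, so [0 <= e] covers it. *)
Lemma bigmax_lipschitz f h (e : R) : 0 <= e -> (forall t, `|f t - h t| <= e) ->
  `|\big[Num.max/0]_t f t - \big[Num.max/0]_t h t| <= e.
Proof.
have half (f1 f2 : T -> R) : 0 <= e -> (forall t, f1 t <= f2 t + e) ->
    \big[Num.max/0]_t f1 t <= \big[Num.max/0]_t f2 t + e.
  move=> e0 H; apply: bigmax_le => [|t _].
    by apply: addr_ge0 => //; exact: bigmax_ge_id.
  by apply: le_trans (H t) _; rewrite lerD2r; exact: le_bigmax.
move=> e0 fh.
have fh1 t : f t <= h t + e by have := fh t; rewrite ler_norml => /andP[]; lra.
have fh2 t : h t <= f t + e by have := fh t; rewrite ler_norml => /andP[]; lra.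
by have := half _ _ e0 fh1; have := half _ _ e0 fh2; rewrite ler_norml; lra.
Qed.

End BigMax.

Section Value.
Variables (R : realType) (S A : finType).
Variables (P : S -> A -> S -> R) (r : S -> A -> R) (g : R).
Hypothesis kerP : is_kernel P.
Hypothesis r01 : forall s a, 0 <= r s a <= 1.
Hypothesis g01 : 0 < g < 1.
Implicit Types (pi : {ffun S -> A}) (s : S) (a : A) (t n : nat).

Let dP s a : is_dist (P s a) := kernel_dist kerP s a.

(** [dist] appends a last step, whereas the Bellman equation conditions on the first one. *)
Lemma dist_recl pi t s s' :
  dist P pi t.+1 s s' = \sum_(s'' : S) P s (pi s) s'' * dist P pi t s'' s'.
Proof.
elim: t s' => [|t IH] s'.
  rewrite /= (bigD1 s) //= eqxx mul1r big1 ?addr0; last first.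
    by move=> i /negPf; rewrite eq_sym eq_sym => ->; rewrite mul0r.
  rewrite [RHS](bigD1 s') //= eqxx mulr1 big1 ?addr0 // => i /negPf.
  by rewrite eq_sym => ->; rewrite mulr0.
rewrite [LHS]/=; under eq_bigr do rewrite -/(dist P pi t.+1 s _) IH mulr_suml.
rewrite exchange_big /=; apply: eq_bigr => i _.
by rewrite mulr_sumr; apply: eq_bigr => j _; rewrite mulrA.
Qed.

Let reward pi t s := \sum_(s' : S) dist P pi t s s' * r s' (pi s').

Lemma reward0 pi s : reward pi 0 s = r s (pi s).
Proof.
rewrite /reward (bigD1 s) //= eqxx mul1r big1 ?addr0 // => i /negPf.
by move=> ->; rewrite mul0r.
Qed.

Lemma rewardS pi t s : reward pi t.+1 s = mean (P s (pi s)) (reward pi t).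
Proof.
rewrite /reward /mean; under eq_bigr do rewrite dist_recl mulr_suml.
rewrite exchange_big /=; apply: eq_bigr => i _.
by rewrite mulr_sumr; apply: eq_bigr => j _; rewrite mulrA.
Qed.

Let partial pi n s := \sum_(0 <= t < n) g ^+ t * reward pi t s.

Lemma partialS pi n s : partial pi n.+1 s = r s (pi s) + g * mean (P s (pi s)) (partial pi n).
Proof.
rewrite /partial big_nat_recl // expr0 mul1r reward0; congr (_ + _).
rewrite /mean mulr_sumr; under [RHS]eq_bigr do rewrite !mulr_sumr.
rewrite exchange_big /=; apply: eq_bigr => t _.
rewrite rewardS /mean mulr_sumr; apply: eq_bigr => s' _.
by rewrite exprS; ring.
Qed.

Lemma partial_bound pi n s : 0 <= partial pi n s <= (1 - g)^-1.
Proof.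
have /andP[g0 g1] := g01; have h0 : 0 < 1 - g by lra.
elim: n s => [|n IH] s; first by rewrite /partial big_geq // lexx invr_ge0 ltW.
rewrite partialS; have /andP[r0 r1] := r01 s (pi s).
have m0 : 0 <= mean (P s (pi s)) (partial pi n).
  by apply: (mean_ge (dP _ _)) => s'; have /andP[] := IH s'.
have m1 : mean (P s (pi s)) (partial pi n) <= (1 - g)^-1.
  by apply: (mean_le (dP _ _)) => s'; have /andP[] := IH s'.
have e : (1 - g) * (1 - g)^-1 = 1 by rewrite mulfV // gt_eqF.
by apply/andP; split; nra.
Qed.

Lemma partial_homo pi s : {homo (fun n => partial pi n s) : n m / (n <= m)%N >-> n <= m}.
Proof.
have /andP[g0 g1] := g01.
have rew0 t s' : 0 <= reward pi t s'.
  elim: t s' => [|t IH] s'; first by rewrite reward0; have /andP[] := r01 s' (pi s').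
  by rewrite rewardS; apply: (mean_ge (dP _ _)).
apply: homo_leq => [x|x y z|n]; [exact: lexx | exact: le_trans |].
rewrite /partial big_nat_recr //=; have := rew0 n s; have := exprn_ge0 n (ltW g0).
by move=> e0 w0; rewrite lerDl mulr_ge0.
Qed.

Lemma partial_cvg pi s : ((fun n => partial pi n s) @ \oo --> Vpi P r g pi s)%classic.
Proof.
apply: nondecreasing_is_cvgn; first exact: partial_homo.
by exists (1 - g)^-1 => _ [n _ <-]; have /andP[] := partial_bound pi n s.
Qed.

(** Limit of [partialS]: the shifted partial sums have the same limit, and a finite mean commutes
    with limits. *)
Lemma Vpi_bellman pi s : Vpi P r g pi s = r s (pi s) + g * mean (P s (pi s)) (Vpi P r g pi).
Proof.
have c1 : ((fun n => partial pi n.+1 s) @ \oo --> Vpi P r g pi s)%classic.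
  by rewrite (cvg_shiftS (fun n => partial pi n s)); exact: partial_cvg.
apply: (cvg_unique _ c1) => //.
rewrite (_ : (fun n => _) = fun n => r s (pi s) + g * mean (P s (pi s)) (partial pi n)); last first.
  by apply/funext => n; exact: partialS.
apply: cvgD; first exact: cvg_cst.
apply: cvgM; first exact: cvg_cst.
apply: cvg_big => [|s' _]; first exact: tvs.add_continuous.
by apply: cvgM; [exact: cvg_cst | exact: partial_cvg].
Qed.

Lemma Vpi_bound pi s : 0 <= Vpi P r g pi s <= (1 - g)^-1.
Proof.
have mP s' : is_dist (P s' (pi s')) := dP s' (pi s').
apply/andP; split.
  rewrite -oppr_le0 -[leRHS](mul0r (1 - g)^-1).
  apply: (max_principle mP g01 (f := fun s => - Vpi P r g pi s)) => s'.
  rewrite meanN add0r mulrN lerN2 (Vpi_bellman pi s') lerDr.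
  by have /andP[] := r01 s' (pi s').
rewrite -[leRHS]mul1r; apply: (max_principle mP g01) => s'.
by rewrite (Vpi_bellman pi s') lerD2r; have /andP[] := r01 s' (pi s').
Qed.

(* A policy maximizing the sum of its values over all states cannot be improved greedily. *)
Lemma optimal_policy (a0 : A) : exists pi,
  (forall s, Vstar P r g s = Vpi P r g pi s) /\
  (forall s a, r s a + g * mean (P s a) (Vpi P r g pi) <= Vpi P r g pi s).
Proof.
pose V := Vpi P r g.
case: (@arg_maxP _ _ _ [ffun=> a0] xpredT (fun pi => \sum_s V pi s) isT) => pi _ pimax.
pose q s a := r s a + g * mean (P s a) (V pi).
pose pi' : {ffun S -> A} := [ffun s => [arg max_(a > a0) q s a]%O].
have greedy s a : q s a <= q s (pi' s).
  by rewrite ffunE; case: arg_maxP => // b _; apply.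
have qV s : V pi s <= q s (pi' s) by rewrite /V (Vpi_bellman pi s); exact: greedy.
(* Along the greedy policy [pi'], the difference [V pi - V pi'] satisfies [f <= g * mean f], hence
   is nonpositive. *)
have improve s : V pi s <= V pi' s.
  rewrite -subr_le0 -[leRHS](mul0r (1 - g)^-1).
  apply: (max_principle (fun s => dP s (pi' s)) g01 (f := fun s => V pi s - V pi' s)) => s'.
  rewrite meanB add0r mulrBr /V (Vpi_bellman pi' s') -/V.
  by have := qV s'; rewrite /q; lra.
(* Pointwise improvement together with maximality of the sum forces equality. *)
have eqV s : V pi' s = V pi s.
  have := pimax pi' isT; rewrite /= => le_sum.
  have e : \sum_s (V pi' s - V pi s) = 0.
    apply/eqP; rewrite eq_le sumr_ge0 ?andbT => [|i _]; last by rewrite subr_ge0.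
    by rewrite sumrB subr_le0.
  apply/eqP; rewrite -subr_eq0; apply/eqP.
  move/eqP: e; rewrite psumr_eq0 => [/allP /(_ s (mem_index_enum _)) /= /eqP -> //|i _].
  by rewrite subr_ge0.
exists pi; have opt s a : q s a <= V pi s.
  apply: le_trans (greedy s a) _; rewrite -[V pi s]eqV /V Vpi_bellman /q.
  by rewrite lerD2l ler_pM2l ?(andP g01).1 // (mean_ext _ (eqV)) .
split=> // s; apply/eqP; rewrite eq_le; apply/andP; split; last exact: (le_bigmax _ (Vpi P r g ^~ s)).
apply: bigmax_le => [|pi2 _]; first by have /andP[] := Vpi_bound pi s.
rewrite -subr_le0 -[leRHS](mul0r (1 - g)^-1).
apply: (max_principle (fun s => dP s (pi2 s)) g01 (f := fun s => V pi2 s - V pi s)) => s'.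
rewrite meanB add0r mulrBr /V (Vpi_bellman pi2 s') -/V.
by have := opt s' (pi2 s'); rewrite /q; lra.
Qed.

Lemma Vstar_bellman (a0 : A) s :
  Vstar P r g s = \big[Num.max/0]_a (r s a + g * mean (P s a) (Vstar P r g)).
Proof.
have [pi [piE opt]] := optimal_policy a0.
have E s' a : mean (P s' a) (Vstar P r g) = mean (P s' a) (Vpi P r g pi) by exact: mean_ext.
apply/eqP; rewrite eq_le; apply/andP; split.
  rewrite piE Vpi_bellman -E.
  exact: (le_bigmax _ (fun a => r s a + g * mean (P s a) (Vstar P r g))).
rewrite piE; apply: bigmax_le => [|a _]; last by rewrite E.
by have /andP[] := Vpi_bound pi s.
Qed.

Lemma Vpi_le_Vstar pi s : Vpi P r g pi s <= Vstar P r g s.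
Proof. exact: (le_bigmax _ (Vpi P r g ^~ s)). Qed.

Lemma Vstar_bound (a0 : A) s : 0 <= Vstar P r g s <= (1 - g)^-1.
Proof. by have [pi [piE _]] := optimal_policy a0; rewrite piE Vpi_bound. Qed.

End Value.

(** * Propagation of one-step errors *)

Section Mixture.
Variables (R : realType) (T I : finType) (c : I -> R) (q : I -> T -> R).

Let mix t := \sum_i c i * q i t.

Lemma mean_mixture f : mean mix f = \sum_i c i * mean (q i) f.
Proof.
rewrite /mean /mix; under eq_bigr do rewrite mulr_suml.
rewrite exchange_big; apply: eq_bigr => i _; rewrite mulr_sumr.
by apply: eq_bigr => t _; rewrite mulrA.
Qed.

Lemma mixture_dist : is_dist c -> (forall i, is_dist (q i)) -> is_dist mix.
Proof.
move=> [c0 c1] qd; split=> [t|].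
  by apply: sumr_ge0 => i _; apply: mulr_ge0 => //; have [] := qd i.
rewrite /mix exchange_big -[RHS]c1; apply: eq_bigr => i _.
by rewrite -mulr_sumr (qd i).2 mulr1.
Qed.

(** Jensen for the component means: the variance of a mixture also contains the variance between its
    components. *)
Lemma mixture_fvar f : is_dist c -> \sum_i c i * fvar (q i) f <= fvar mix f.
Proof.
move=> cd; rewrite /fvar !mean_mixture; under eq_bigr do rewrite mulrBr.
rewrite sumrB lerD2l lerN2.
exact: (sqr_mean_le cd (fun i => mean (q i) f)).
Qed.

End Mixture.

(** The law [v] and the function [h] of the variance term are kept separate from [p], [q] and [f]:
    errors are needed in both directions, and the error of [V + x V^2] is bounded by the variance of
    [V]. *)
Lemma mixture_bernstein (R : realType) (T I : finType) (c : I -> R) (p q v : I -> T -> R)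
    f h (x y : R) : is_dist c -> 0 <= x ->
  (forall i, mean (p i) f - mean (q i) f <= x * fvar (v i) h + y) ->
  mean (fun t => \sum_i c i * p i t) f - mean (fun t => \sum_i c i * q i t) f <=
    x * fvar (fun t => \sum_i c i * v i t) h + y.
Proof.
move=> cd x0 dev.
apply: (@le_trans _ _ (x * \sum_i c i * fvar (v i) h + y)); last first.
  by rewrite lerD2r; apply: ler_wpM2l => //; exact: mixture_fvar.
rewrite !mean_mixture -sumrB -[X in _ + X](mean_cst cd) /mean mulr_sumr -big_split.
apply: ler_sum => i _; rewrite /= -mulrBr mulrCA -mulrDr.
by apply: ler_wpM2l (dev i); exact: cd.1.
Qed.


Section ErrorPropagation.
Variables (R : realType) (S A : finType).
Variables (P Ph : S -> A -> S -> R) (r : S -> A -> R) (g : R).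
Hypothesis kerP : is_kernel P.
Hypothesis kerPh : is_kernel Ph.
Hypothesis r01 : forall s a, 0 <= r s a <= 1.
Hypothesis g01 : 0 < g < 1.
Variable pi : {ffun S -> A}.
Let H := (1 - g)^-1.
Let Pp s := P s (pi s).
Let Php s := Ph s (pi s).

(* The total variance of [V] under the discounted dynamics of [Ph] is controlled by
   applying the maximum principle to [V - Vh + x V^2]. *)
Lemma value_upper_deviation (x y : R) : 0 <= x -> 0 <= y ->
  let V := Vpi P r g pi in
  let G s := V s + x * V s ^+ 2 in
  (forall s, mean (Pp s) G - mean (Php s) G <= x * fvar (Pp s) V + y) ->
  forall s, V s - Vpi Ph r g pi s <= (2 * x * H + y) * H.
Proof.
move=> x0 y0 V G dev s; have /andP[g0 g1] := g01; set Vh := Vpi Ph r g pi.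
apply: (@le_trans _ _ (V s - Vh s + x * V s ^+ 2)).
  by rewrite lerDl; apply: mulr_ge0 => //; exact: sqr_ge0.
apply: (max_principle (fun s => kernel_dist kerPh s (pi s)) g01
  (f := fun s => V s - Vh s + x * V s ^+ 2)) => t.
have := dev t; rewrite /fvar /G !(meanB, meanD, meanZ) -/(Php t).
have V0H := Vpi_bound kerP r01 g01 pi t.
have := Vpi_bellman kerP r01 g01 pi t; have := Vpi_bellman kerPh r01 g01 pi t.
rewrite -/V -/Vh -/(Pp t) -/(Php t) in V0H *.
have /andP[r0 r1] := r01 t (pi t).
move: (r t _) r0 r1 => rt r0 r1.
move: (V t) V0H => v /andP[v0 vH]; move: (Vh t) => vh.
move: (mean (Pp t) V) (mean (Pp t) (fun s => V s ^+ 2)) (mean (Php t) V) (mean (Php t) Vh)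
  (mean (Php t) (fun s => V s ^+ 2)) => m m2 mh mhh m2h evh ev D.
(* The term [x * m2] coming from [G] cancels the one in the variance. What remains is [x * m2h],
   taken under the kernel [Php] of the recursion. *)
have D' : m - mh <= x * m2h - x * m ^+ 2 + y by lra.
have gD : g * (m - mh) <= g * (x * m2h - x * m ^+ 2 + y) by rewrite ler_pM2l.
(* Since [g * m = v - rt], the difference is at most [2 * v * rt - rt ^+ 2]. *)
have vm : v ^+ 2 - g * m ^+ 2 <= 2 * H.
  have : (g * m) ^+ 2 <= g * m ^+ 2.
    by rewrite exprMn ler_wpM2r ?sqr_ge0 // expr2 ger_pMl // ltW.
  have -> : g * m = v - rt by lra.
  rewrite -/H in vH; have := sqr_ge0 rt; have : v * rt <= v * 1 by apply: ler_wpM2l.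
  by lra.
have xvm : x * (v ^+ 2 - g * m ^+ 2) <= x * (2 * H) by apply: ler_wpM2l.
have gy : g * y <= y by nra.
by rewrite evh {1}ev; lra.
Qed.

(* [D] is the one-step error; its own size enters the variance bound, whence the factors 2. *)
Lemma variance_self_bound (U m m2 rt e D x y : R) :
  0 <= U <= H -> 0 <= m -> m ^+ 2 <= m2 -> rt <= 1 -> 0 <= e -> 0 <= y ->
  0 <= x -> 4 * x * H <= 1 ->
  U - rt - e - D <= g * m -> D <= g * (x * (m2 - m ^+ 2) + y) ->
  D <= 2 * x * (g * m2 - U ^+ 2) + 4 * x * H + 2 * y + e.
Proof.
move=> /andP[U0 UH] m0 mm2 r1 e0 y0 x0 xH low DD; have /andP[g0 g1] := g01.
have gm0 : 0 <= g * m by apply: mulr_ge0 => //; exact: ltW.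
have gm2 : (g * m) ^+ 2 <= g * m ^+ 2.
  by rewrite exprMn ler_wpM2r ?sqr_ge0 // expr2 ger_pMl // ltW.
(* For [a > U] the left side of the conclusion is nonpositive; otherwise the hypothesis can be
   squared. *)
have square_low a : 0 <= a -> U - a <= g * m -> U ^+ 2 - 2 * U * a <= g * m ^+ 2.
  move=> a0 Ua; apply: le_trans gm2; case: (lerP a U) => aU; last by nra.
  have : (U - a) ^+ 2 <= (g * m) ^+ 2 by rewrite ler_sqr // nnegrE subr_ge0.
  nra.
have xU : x * U <= x * H by apply: ler_wpM2l.
have xU0 : 0 <= x * U by apply: mulr_ge0.
have xUe : 4 * (x * U * e) <= e by nra.
have gy : g * y <= y by nra.
(* If [D <= 0], the right side is already nonnegative. Otherwise the variance produces
   [4 * (x * U * D) <= D], which is absorbed on the left. *)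
case: (lerP D 0) => D0.
  have low0 : U ^+ 2 - 2 * U * (1 + e) <= g * m ^+ 2 by apply: square_low; lra.
  have gv : g * m ^+ 2 <= g * m2 by rewrite ler_pM2l.
  have : x * (U ^+ 2 - 2 * U * (1 + e)) <= x * (g * m2).
    by apply: ler_wpM2l => //; exact: le_trans gv.
  lra.
have low1 : U ^+ 2 - 2 * U * (1 + e + D) <= g * m ^+ 2 by apply: square_low; lra.
have : x * (U ^+ 2 - 2 * U * (1 + e + D)) <= x * (g * m ^+ 2) by apply: ler_wpM2l.
have : 4 * (x * U * D) <= D by nra.
lra.
Qed.

(** Maximum principle under [Pp] for [W - V + 2 * x * U ^+ 2]. The deviation is assumed at [U],
    later the empirical optimal value, and not at [W], because [pi] may depend arbitrarily on the
    samples. *)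
Lemma value_lower_deviation (U : S -> R) (x y e : R) : 0 <= x -> 4 * x * H <= 1 ->
  0 <= y -> 0 <= e ->
  let W := Vpi Ph r g pi in
  (forall s, 0 <= U s <= H) -> (forall s, U s - e <= W s <= U s) ->
  (forall s, mean (Php s) U - mean (Pp s) U <= x * fvar (Pp s) U + y) ->
  forall s, W s - Vpi P r g pi s <= (4 * x * H + 2 * y + 2 * e) * H.
Proof.
move=> x0 xH y0 e0 W U0H UW dev s; have /andP[g0 g1] := g01; set V := Vpi P r g pi.
have dP t : is_dist (Pp t) by exact: kernel_dist.
have dPh t : is_dist (Php t) by exact: kernel_dist.
apply: (@le_trans _ _ (W s - V s + 2 * x * U s ^+ 2)).
  by rewrite lerDl; apply: mulr_ge0; [lra | exact: sqr_ge0].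
apply: (max_principle dP g01 (f := fun s => W s - V s + 2 * x * U s ^+ 2)) => t.
rewrite !(meanB, meanD, meanZ).
have := Vpi_bellman kerP r01 g01 pi t; have := Vpi_bellman kerPh r01 g01 pi t.
rewrite -/V -/W -/(Pp t) -/(Php t).
have [r0 r1] := andP (r01 t (pi t)).
have mhWU : mean (Php t) W <= mean (Php t) U.
  by apply: (ler_mean (dPh t)) => s'; have /andP[] := UW s'.
have mWU : mean (Pp t) U - e <= mean (Pp t) W.
  rewrite -[X in _ - X](mean_cst (dP t)) -meanB.
  by apply: (ler_mean (dP t)) => s'; have /andP[] := UW s'.
have /andP[uW _] := UW t; have u0H := U0H t.
have mU0 : 0 <= mean (Pp t) U by apply: (mean_ge (dP t)) => s'; have /andP[] := U0H s'.
have mm2 := sqr_mean_le (dP t) U.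
move: (dev t); rewrite /fvar.
move: (r t _) r1 (mean (Pp t) (fun s => U s ^+ 2)) (mean (Pp t) U) mm2 mU0 mWU.
move=> rt r1 m2 m mm2 m0 + dm.
move: (mean (Php t) W) (mean (Pp t) W) (mean (Pp t) V) (mean (Php t) U) mhWU dm.
move=> mhW mW mV mh mhWU dm mWU.
move: (W t) (V t) (U t) u0H uW => w v u u0H uW evw ev.
have ghW : g * mhW <= g * mh by rewrite ler_pM2l.
have gW : g * (mhW - mW) <= g * (mh - m + e) by rewrite ler_pM2l //; lra.
have low : u - rt - e - g * (mh - m) <= g * m by lra.
have DD : g * (mh - m) <= g * (x * (m2 - m ^+ 2) + y) by rewrite ler_pM2l //; lra.
have := variance_self_bound u0H m0 mm2 r1 e0 y0 x0 xH low DD.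
have : g * e <= e by nra.
rewrite evw {1}ev; lra.
Qed.

End ErrorPropagation.

(** * Leave-one-out value functions *)

Section LeaveOneOut.
Variables (R : realType) (S A : finType) (K N : nat).
Variables (r : S -> A -> R) (g : R) (lam : S -> A -> 'I_K -> R).
Hypothesis N0 : (0 < N)%N.
Hypothesis r01 : forall s a, 0 <= r s a <= 1.
Hypothesis g01 : 0 < g < 1.
Hypothesis lam_dist : forall s a, is_dist (lam s a).
Hypothesis a0 : A.
Implicit Types (w : outcome S K N) (k : 'I_K) (u : R).
Let H := (1 - g)^-1.

Lemma PhatK_dist w k : is_dist (PhatK R w k).
Proof.
split=> [s|]; first by rewrite /PhatK divr_ge0.
have := mean_PhatK w k (fun=> 1 : R); rewrite sumr_const card_ord divff ?pnatr_eq0 -?lt0n //.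
by rewrite /mean => <-; apply: eq_bigr => s _; rewrite mulr1.
Qed.

Lemma Phat_kernel w : is_kernel (Phat lam w).
Proof.
have d s a : is_dist (Phat lam w s a) by apply: mixture_dist => // k; exact: PhatK_dist.
by split=> s a; have [] := d s a.
Qed.

(* The optimal Bellman operator of the empirical MDP with the row [k] of the
   empirical anchor kernel removed and the reward [u] paid in its place. *)
Definition loo_bellman k u w (V : S -> R) (s : S) : R :=
  \big[Num.max/0]_a (r s a + lam s a k * u +
    g * \sum_(i | i != k) lam s a i * mean (PhatK R w i) V).

(** Finitely many value iterations replace the fixed point; the remainder [g ^+ n * H] is made small
    by the choice of [n]. *)
Definition loo_value k u n w : S -> R := iter n (loo_bellman k u w) (fun=> 0).

Lemma loo_value_resample k u n w v : loo_value k u n (resample w k v) = loo_value k u n w.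
Proof.
rewrite /loo_value; elim: n => //= n ->; apply/funext => s.
rewrite /loo_bellman; apply: eq_bigr => a _; congr (_ + _ * _).
apply: eq_bigr => i /negPf ik; congr (_ * _).
by apply: eq_bigr => s' _; rewrite /PhatK ffunE ik.
Qed.

(** With the exact reward [g * mean (PhatK R w k) U] the empirical optimal value is a fixed point of
    [loo_bellman]. A reward error [d] enters with weight at most 1 per step and accumulates to
    [d * H], because [d + g * (d * H) = d * H]. *)
Lemma loo_value_close k u n w s :
  `|Vstar (Phat lam w) r g s - loo_value k u n w s| <=
  g ^+ n * H + `|u - g * mean (PhatK R w k) (Vstar (Phat lam w) r g)| * H.
Proof.
set U := Vstar (Phat lam w) r g; set d := `|u - _|; have /andP[g0 g1] := g01.
have h0 : 0 < 1 - g by lra.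
have eH : (1 - g) * H = 1 by rewrite mulfV // gt_eqF.
have H0 : 0 <= H by rewrite invr_ge0 ltW.
have kerh := Phat_kernel w.
have d0 : 0 <= d by exact: normr_ge0.
elim: n s => [|n IH] s.
  rewrite /loo_value /= subr0 expr0 mul1r.
  have /andP[U0 UH] := Vstar_bound kerh r01 g01 a0 s.
  by rewrite ger0_norm // -[leLHS]addr0; apply: lerD => //; exact: mulr_ge0.
rewrite /loo_value iterS -/(loo_value k u n w) /U (Vstar_bellman kerh r01 g01 a0 s) -/U.
set V := loo_value k u n w in IH *.
apply: bigmax_lipschitz => [|a].
  by apply: addr_ge0; apply: mulr_ge0 => //; rewrite exprn_ge0 // ltW.
rewrite [mean (Phat lam w s a) U](mean_mixture (lam s a) (PhatK R w)) (bigD1 k) //=.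
set X := g ^+ n * H + d * H in IH.
have X0 : 0 <= X by apply: addr_ge0; apply: mulr_ge0 => //; rewrite exprn_ge0 // ltW.
have -> : g ^+ n.+1 * H + d * H = d + g * X.
  by have := congr1 (fun z => z * d) eH; rewrite /= /X exprS; lra.
set SU := \sum_(_ | _) _; set SV := \sum_(_ | _) _; set mU := mean _ U.
have -> : r s a + g * (lam s a k * mU + SU) - (r s a + lam s a k * u + g * SV) =
   - (lam s a k * (u - g * mU)) + g * (SU - SV) by ring.
apply: le_trans (ler_normD _ _) _; rewrite normrN !normrM (gtr0_norm g0).
have [l0 l1] := lam_dist s a.
have lk : lam s a k <= 1 by rewrite -l1 (bigD1 k) //= lerDl; apply: sumr_ge0.
apply: lerD; first by rewrite ger0_norm // ler_piMl.
rewrite ler_pM2l // /SU /SV -sumrB.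
apply: le_trans (ler_norm_sum _ _ _) _.
apply: (@le_trans _ _ (\sum_(i | i != k) lam s a i * X)).
  apply: ler_sum => i _; rewrite -mulrBr -meanB normrM ger0_norm //.
  by apply: ler_wpM2l => //; apply: (mean_norm_le (PhatK_dist w i)).
rewrite -mulr_suml ler_piMl // -l1 [leRHS](bigD1 k) //= lerDr //.
Qed.

(** The deviation is measured only at the deterministic function [Vstar P r g]; the difference of
    the two optimal values is contracted by the empirical kernel. *)
Lemma Vstar_kernel_perturb (P : S -> A -> S -> R) w (e : R) : is_kernel P ->
  (forall s a, `|mean (Phat lam w s a) (Vstar P r g) - mean (P s a) (Vstar P r g)| <= e) ->
  0 <= e ->
  forall s, `|Vstar (Phat lam w) r g s - Vstar P r g s| <= e * H.
Proof.
move=> kerP dev e0; have /andP[g0 g1] := g01; have kerh := Phat_kernel w.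
set U := Vstar (Phat lam w) r g; set V := Vstar P r g.
apply: (contraction_bound g01 (f := fun s => `|U s - V s|)) => m Um s.
have m0 : 0 <= m by apply: le_trans (Um s).
rewrite /U /V (Vstar_bellman kerh r01 g01 a0 s) (Vstar_bellman kerP r01 g01 a0 s) -/U -/V.
apply: bigmax_lipschitz => [|a]; first by apply: addr_ge0 => //; apply: mulr_ge0 => //; exact: ltW.
have -> : r s a + g * mean (Phat lam w s a) U - (r s a + g * mean (P s a) V) =
  g * (mean (Phat lam w s a) V - mean (P s a) V) + g * mean (Phat lam w s a) (fun s => U s - V s).
  by rewrite meanB; ring.
apply: le_trans (ler_normD _ _) _; rewrite !normrM (gtr0_norm g0); apply: lerD.
  by have := dev s a; have := normr_ge0 (mean (Phat lam w s a) V - mean (P s a) V); nra.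
by rewrite ler_pM2l //; apply: mean_norm_le => //; exact: (kernel_dist kerh).
Qed.

End LeaveOneOut.

Section Clamp.
Variable R : realType.

(** A large grid reward can push leave-one-out iterates above [H]. Clamping restores a uniform bound
    and preserves closeness to a value in [[0, H]]. *)
Definition clamp (H z : R) := Num.min H (Num.max 0 z).

Lemma clamp_bound (H z : R) : 0 <= H -> 0 <= clamp H z <= H.
Proof. by move=> H0; rewrite le_min H0 le_max lexx ge_min lexx. Qed.

Lemma clamp_close (H z u e : R) : 0 <= u <= H -> `|u - z| <= e -> `|clamp H z - u| <= e.
Proof.
rewrite !ler_norml /clamp => /andP[u0 uH] /andP[e1 e2].
by case: (leP 0 z) => z0; [case: (leP H z) | case: (leP H 0)] => zH; lra.
Qed.

End Clamp.

(** * The good event *)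

(** Two [tau] come from exchanging [f] for [u] in the means. The third bounds [x * tau ^+ 2 / 2],
    left by the variance exchange, whose factor 2 the coefficient [x / 4] accommodates. *)
Lemma bernstein_transfer (R : realType) (T : finType) (p q f u : T -> R) (x y tau : R) :
  is_dist p -> is_dist q -> (forall t, `|f t - u t| <= tau) -> 0 <= x -> x * tau <= 2 ->
  mean q f - mean p f <= x / 4 * fvar p f + y ->
  mean q u - mean p u <= x * fvar p u + (y + 3 * tau).
Proof.
move=> pd qd fu x0 xt dev.
have fu1 : mean p f - mean p u <= tau.
  rewrite -meanB; apply: (mean_le pd) => t; exact: le_trans (ler_norm _) (fu t).
have fu2 : mean q u - mean q f <= tau.
  rewrite -meanB; apply: (mean_le qd) => t.
  by apply: le_trans (fu t); rewrite distrC ler_norm.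
have v : x * fvar p f <= x * (2 * fvar p u + 2 * tau ^+ 2).
  by apply: ler_wpM2l => //; exact: fvar_perturb.
have v0 : 0 <= x * fvar p u by apply: mulr_ge0 => //; exact: fvar_ge0.
have tau0 : 0 <= mean p (fun=> tau).
  by apply: (mean_ge pd) => t; apply: le_trans (fu t).
rewrite (mean_cst pd) in tau0.
have : x * tau ^+ 2 <= 2 * tau by rewrite expr2 mulrA; apply: ler_wpM2r.
lra.
Qed.

Section GoodEvent.
Variables (R : realType) (S A : finType) (K N : nat).
Variables (P : S -> A -> S -> R) (r : S -> A -> R) (g : R).
Variables (sk : 'I_K -> S) (ak : 'I_K -> A) (lam : S -> A -> 'I_K -> R).
Hypothesis N0 : (0 < N)%N.
Hypothesis kerP : is_kernel P.
Hypothesis r01 : forall s a, 0 <= r s a <= 1.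
Hypothesis g01 : 0 < g < 1.
Hypothesis lam_dist : forall s a, is_dist (lam s a).
Hypothesis P_mix : forall s a, P s a = fun s' => \sum_k lam s a k * P (sk k) (ak k) s'.
Hypothesis a0 : A.
Variable w : outcome S K N.
Let H := (1 - g)^-1.
Let Pk k := P (sk k) (ak k).
Let V := Vstar P r g.
Let U := Vstar (Phat lam w) r g.

(** Chain [V], the empirical value of the optimal policy [pis], [U], [W], the true value of [pihat].
    The second link costs nothing, the third costs [e <= e * H], and the outer two are the deviation
    lemmas. *)
Lemma plug_in_error (pihat : {ffun S -> A}) (x y tau e : R) :
  0 <= x -> 4 * x * H <= 1 -> 0 <= y -> 0 <= tau -> 0 <= e ->
  let G s := V s + x * V s ^+ 2 in
  (forall k, mean (Pk k) G - mean (PhatK R w k) G <= x * fvar (Pk k) V + y) ->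
  (forall k, mean (PhatK R w k) U - mean (Pk k) U <= x * fvar (Pk k) U + (y + 3 * tau)) ->
  (forall s, U s - e <= Vpi (Phat lam w) r g pihat s) ->
  forall s a, Qstar P r g s a - ((6 * x * H + 3 * y + 6 * tau) * H + 3 * e * H) <=
    Qpi P r g pihat s a.
Proof.
move=> x0 xH y0 tau0 e0 G devV devU Ue s a; have /andP[g0 g1] := g01.
have H1 : 1 <= H by rewrite invf_ge1; lra.
have kerh : is_kernel (Phat lam w) by exact: Phat_kernel.
have [pis [pisE _]] := optimal_policy kerP r01 g01 a0.
have VE : V = Vpi P r g pis by apply/funext => t; exact: pisE.
have lower t : V t - Vpi (Phat lam w) r g pis t <= (2 * x * H + y) * H.
  rewrite VE; apply: value_upper_deviation => // t'.
  rewrite -VE -/G P_mix; exact: (mixture_bernstein (lam_dist _ _) x0 devV).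
set W := Vpi (Phat lam w) r g pihat.
have WU t : W t <= U t by exact: Vpi_le_Vstar.
have upper t : W t - Vpi P r g pihat t <= (4 * x * H + 2 * (y + 3 * tau) + 2 * e) * H.
  apply: (value_lower_deviation kerP kerh r01 g01 (U := U)) => //.
  - by apply: addr_ge0 => //; lra.
  - by move=> t'; exact: (Vstar_bound kerh r01 g01 a0).
  - by move=> t'; rewrite Ue WU.
  - by move=> t'; rewrite P_mix; exact: (mixture_bernstein (lam_dist _ _) x0 devU).
have e1 : e <= e * H by rewrite ler_peMr.
have gap t : V t - Vpi P r g pihat t <= (6 * x * H + 3 * y + 6 * tau) * H + 3 * e * H.
  have := lower t; have := upper t; have := Ue t.
  have : Vpi (Phat lam w) r g pis t <= U t by exact: Vpi_le_Vstar.
  rewrite -/W; lra.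
rewrite /Qstar /Qpi -/V lerBlDr -addrA lerD2l.
set b := _ + 3 * e * H in gap *.
have b0 : 0 <= b.
  have H0 : 0 <= H by apply: le_trans H1.
  by rewrite /b; apply: addr_ge0; apply: mulr_ge0 => //; try lra; nra.
have : mean (P s a) V - mean (P s a) (Vpi P r g pihat) <= b.
  by rewrite -meanB; apply: (mean_le (kernel_dist kerP s a)).
rewrite -/(mean (P s a) V) -/(mean (P s a) (Vpi P r g pihat)); nra.
Qed.

Lemma Vstar_crude (eps : R) :
  (forall k, `|mean (PhatK R w k) V - mean (Pk k) V| <= eps) ->
  0 <= eps -> forall s, `|U s - V s| <= eps * H.
Proof.
move=> dev eps0; apply: Vstar_kernel_perturb => // s a.
rewrite P_mix [mean (Phat _ _ _ _) _](mean_mixture (lam s a) (PhatK R w)) mean_mixture -sumrB.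
apply: le_trans (ler_norm_sum _ _ _) _.
rewrite -[leRHS](mean_cst (lam_dist s a)); apply: ler_sum => k _.
by rewrite -mulrBr normrM ger0_norm ?(lam_dist s a).1 // ler_wpM2l ?(lam_dist s a).1.
Qed.

(** Gives the grid radius: [eps * H] for replacing [U] by [V], and [eps <= eps * H] for replacing
    the empirical row by the true one. *)
Lemma loo_reward_close (eps : R) (k : 'I_K) :
  (forall k, `|mean (PhatK R w k) V - mean (Pk k) V| <= eps) -> 0 <= eps ->
  `|g * mean (PhatK R w k) U - g * mean (Pk k) V| <= 2 * eps * H.
Proof.
move=> dev eps0; have /andP[g0 g1] := g01.
have H1 : 1 <= H by rewrite invf_ge1; lra.
have UV : `|mean (PhatK R w k) U - mean (PhatK R w k) V| <= eps * H.
  rewrite -meanB; apply: (mean_norm_le (PhatK_dist R N0 w k)); exact: Vstar_crude.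
rewrite -mulrBr normrM (gtr0_norm g0).
have : `|mean (PhatK R w k) U - mean (Pk k) V| <= eps * H + eps.
  have -> : mean (PhatK R w k) U - mean (Pk k) V =
    (mean (PhatK R w k) U - mean (PhatK R w k) V) +
    (mean (PhatK R w k) V - mean (Pk k) V) by ring.
  by apply: le_trans (ler_normD _ _) _; apply: lerD.
have e1 : eps <= eps * H by rewrite ler_peMr.
have := normr_ge0 (mean (PhatK R w k) U - mean (Pk k) V).
move: `|_| => z z0 ze; have : g * z <= z by nra.
lra.
Qed.

End GoodEvent.

Lemma grid_approx (R : realType) (u c b e : R) : 0 < e -> `|u - c| <= b ->
  exists2 j : nat, j%:R <= 2 * b / e & `|c - b + j%:R * e - u| <= e.
Proof.
move=> e0; rewrite ler_norml => /andP[u1 u2].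
pose z := (u - c + b) / e.
have z0 : 0 <= z by apply: divr_ge0; lra.
have ze : z * e = u - c + b by rewrite mulfVK // gt_eqF.
have /andP[j1 j2] := truncn_itv z0.
exists (Num.trunc z).
  by apply: le_trans j1 _; rewrite /z ler_pM2r ?invr_gt0 //; lra.
rewrite -natr1 in j2.
by rewrite ler_norml; apply/andP; split; nra.
Qed.

Lemma natr_ceil_bound (R : realType) (z : R) : 0 <= z ->
  (Num.trunc z).+1%:R <= z + 1.
Proof. by move=> z0; rewrite -natr1 lerD2r; have /andP[] := truncn_itv z0. Qed.

(** * Test functions and the error budget *)

Section Main.
Variables (R : realType) (S A : finType) (K N : nat).
Variables (P : S -> A -> S -> R) (r : S -> A -> R) (g : R).
Variables (sk : 'I_K -> S) (ak : 'I_K -> A) (lam : S -> A -> 'I_K -> R).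
Hypothesis N0 : (0 < N)%N.
Hypothesis kerP : is_kernel P.
Hypothesis r01 : forall s a, 0 <= r s a <= 1.
Hypothesis g01 : 0 < g < 1.
Hypothesis lam_dist : forall s a, is_dist (lam s a).
Hypothesis P_mix : forall s a, P s a = fun s' => \sum_k lam s a k * P (sk k) (ak k) s'.
Hypothesis a0 : A.
Let H := (1 - g)^-1.
Let Pk k := P (sk k) (ak k).
Let V := Vstar P r g.

Variables (eps x y eta : R).
Hypothesis eps0 : 0 < eps.
Hypothesis eps1 : eps * (1 - g) <= 1.
Hypothesis xH : x * H = eps * (1 - g) / 16.
Hypothesis etaH : eta * H = eps * (1 - g) / 96.
Hypothesis y0 : 0 <= y.
Hypothesis y1 : 6 * y <= eps * (1 - g).

(** A grid of radius [2 * eps * H] and step [eta = eps * (1 - g) ^+ 2 / 96] has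
    [4 * eps * H / eta = 384 * H ^+ 3] steps. *)
Let M := (Num.trunc (384 * H ^+ 3)).+1.

(* Test functions: [-(V + x V^2)] drives the error at the optimal policy, [V] and [-V]
   localize the centre of the grid, and the rest covers the empirical optimal value. *)
Definition test_function n (k : 'I_K) (j : option (option (option 'I_M)))
    (w : outcome S K N) (s : S) : R :=
  match j with
  | None => - (V s + x * V s ^+ 2)
  | Some None => V s
  | Some (Some None) => - V s
  | Some (Some (Some j)) =>
      clamp H (loo_value r g lam k (g * mean (Pk k) V - 2 * eps * H + j%:R * eta) n w s)
  end.

(** The budget adds up to [eps]: [6 * x * H * H] is [3 / 8] of it, [3 * y * H] at most [1 / 2], and
    [6 * tau * H] is [1 / 8]. *)
Lemma good_event n (w : outcome S K N) (pihat : {ffun S -> A}) (e : R) :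
  0 <= e -> (forall s, Vstar (Phat lam w) r g s - e <= Vpi (Phat lam w) r g pihat s) ->
  g ^+ n * H <= eps * (1 - g) / 96 ->
  (forall k j, mean (PhatK R w k) (test_function n k j w) <=
     mean (Pk k) (test_function n k j w) +
     2 * (x / 8) * fvar (Pk k) (test_function n k j w) + y) ->
  forall s a, Qstar P r g s a - eps - 3 * e * H <= Qpi P r g pihat s a.
Proof.
have [Y0 Y1 E0 E1] := And4 y0 y1 eps0 eps1; have XH := xH; have EH := etaH.
move=> e0 opt gn dev s a; have /andP[g0 g1] := g01.
have h0 : 0 < 1 - g by lra.
have hH : (1 - g) * H = 1 by rewrite mulfV // gt_eqF.
have H0 : 0 < H by rewrite invr_gt0.
have eh0 : 0 < eps * (1 - g) by exact: mulr_gt0.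
have ehH : eps * (1 - g) * H = eps by rewrite -mulrA hH mulr1.
have xHH : x * H * H = eps / 16 by rewrite xH; lra.
have x0 : 0 < x by rewrite -(pmulr_lgt0 _ H0) xH; lra.
have eta0 : 0 < eta by rewrite -(pmulr_lgt0 _ H0) etaH; lra.
(* Half of [tau] pays for truncating the iteration, half for the grid step. *)
pose tau := eps * (1 - g) / 48.
have tau0 : 0 < tau by rewrite /tau; lra.
have tauH : tau * H = eps / 48 by rewrite /tau; lra.
have tauE : tau = eps * (1 - g) / 48 by [].
clearbody tau.
have VH t : 0 <= V t <= H by exact: Vstar_bound.
have VnH t : `|V t| <= H by have /andP[V0 V1] := VH t; rewrite ger0_norm.
have Pkd k : is_dist (Pk k) by exact: kernel_dist.
(* A crude bound suffices here, since it only localizes the grid: the variance is at most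
   [H ^+ 2]. *)
have devV k : `|mean (PhatK R w k) V - mean (Pk k) V| <= eps.
  have v := fvar_le_sqr (Pkd k) VnH; have v0 := fvar_ge0 (Pkd k) V.
  have xv : x * fvar (Pk k) V <= eps / 16 by rewrite -xHH -mulrA -expr2 ler_pM2l.
  have d2 : - mean (PhatK R w k) V <= - mean (Pk k) V + 2 * (x / 8) * fvar (Pk k) V + y.
    by have := dev k (Some (Some None)); rewrite /test_function !meanN fvarN.
  have d1 : mean (PhatK R w k) V <= mean (Pk k) V + 2 * (x / 8) * fvar (Pk k) V + y :=
    dev k (Some None).
  have eh : eps * (1 - g) <= eps by rewrite ger_pMr //; lra.
  by rewrite ler_norml; apply/andP; split; lra.
have := plug_in_error N0 kerP r01 g01 lam_dist P_mix a0 (w := w) (pihat := pihat)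
  (x := x) (y := y) (tau := tau) (e := e).
rewrite -/H => err; apply: le_trans (err (ltW x0) _ y0 (ltW tau0) e0 _ _ opt s a); first last.
- move=> k; rewrite -/(Pk k).
  set U := Vstar (Phat lam w) r g.
  have close := loo_reward_close N0 kerP r01 g01 lam_dist P_mix a0 k devV (ltW eps0).
  have [j jle jclose] := grid_approx eta0 close.
  rewrite -/H -/U -/V -/(Pk k) in jle jclose.
  have jM : (j < M)%N.
    have H30 : 0 <= 384 * H ^+ 3 by apply: mulr_ge0 (ler0n _ _) (exprn_ge0 _ (ltW H0)).
    rewrite ltnS truncn_ge_nat; last exact: H30.
    apply: le_trans jle _; rewrite ler_pdivrMr; last exact: eta0.
    have : 384 * H ^+ 3 * eta = 384 * H * (eta * H * H) by ring.
    have -> : eta * H * H = eps / 96 by rewrite etaH; lra.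
    lra.
  have := dev k (Some (Some (Some (Ordinal jM)))); rewrite /test_function /=.
  set u := _ + j%:R * eta in jclose *; set f := fun t => clamp _ _ => devf.
  apply: (@bernstein_transfer _ _ _ _ f) => //.
  + exact: PhatK_dist.
  + move=> t; apply: clamp_close; first exact: (Vstar_bound (Phat_kernel N0 lam_dist w) r01 g01 a0).
    apply: le_trans (loo_value_close N0 r01 g01 lam_dist a0 k u n w t) _.
    rewrite -/H -/U.
    have : `|u - g * mean (PhatK R w k) U| * H <= eta * H by rewrite ler_pM2r.
    by lra.
  + exact: ltW.
  + have H1 : 1 <= H by rewrite invf_ge1; lra.
    have x1 : x <= x * H by rewrite ler_peMr // ltW.
    apply: (@le_trans _ _ (1 * 1)); last by lra.
    by apply: ler_pM; [exact: ltW | exact: ltW | lra | lra].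
  + by lra.
- move=> k; rewrite -/V -/(Pk k).
  have := dev k None; rewrite /test_function !meanN fvarN.
  (* The factor 4 cancels against [2 * (x / 8) = x / 4]. *)
  have v : fvar (Pk k) (fun t => V t + x * V t ^+ 2) <= 4 * fvar (Pk k) V.
    apply: (fvar_add_sqr (Pkd k) VH); first exact: ltW.
    by rewrite -mulrA xH; lra.
  have : x / 4 * fvar (Pk k) (fun t => V t + x * V t ^+ 2) <= x / 4 * (4 * fvar (Pk k) V).
    by apply: ler_wpM2l => //; lra.
  lra.
- by rewrite -mulrA xH; lra.
have : 3 * y * H <= eps / 2.
  have : 6 * y * H <= eps * (1 - g) * H by rewrite ler_pM2r.
  lra.
lra.
Qed.
Lemma test_function_resample n k j (w : outcome S K N) v :
  test_function n k j (resample w k v) = test_function n k j w.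
Proof.
by case: j => [[[j|]|]|] //=; apply/funext => s; rewrite /= loo_value_resample.
Qed.

Lemma test_function_bound n k j (w : outcome S K N) s : `|test_function n k j w s| <= 2 * H.
Proof.
have /andP[g0 g1] := g01; have XH := xH; have E1 := eps1.
have H0 : 0 < H by rewrite invr_gt0; lra.
have /andP[V0 V1] : 0 <= V s <= H by exact: Vstar_bound.
have x0 : 0 <= x.
  rewrite -(pmulr_lge0 _ H0) xH; apply: divr_ge0 => //.
  by apply: mulr_ge0; [exact: ltW | lra].
case: j => [[[j|]|]|] /=; rewrite ?normrN.
- have /andP[c0 c1] := clamp_bound
    (loo_value r g lam k (g * mean (Pk k) V - 2 * eps * H + j%:R * eta) n w s) (ltW H0).
  by rewrite ger0_norm //; lra.
- by rewrite ger0_norm //; lra.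
- by rewrite ger0_norm //; lra.
have xV : x * V s <= 1 by apply: (@le_trans _ _ (x * H)); [exact: ler_wpM2l | lra].
have : x * V s ^+ 2 <= V s by rewrite expr2 mulrA ler_piMl.
have : 0 <= x * V s ^+ 2 by apply: mulr_ge0 => //; exact: sqr_ge0.
by move=> h0 h1; rewrite ger0_norm; lra.
Qed.

End Main.

(** * Sample complexity *)

Lemma expn_small (R : realType) (g e : R) : 0 < g < 1 -> 0 < e -> exists n, g ^+ n <= e.
Proof.
move=> /andP[g0 g1] e0.
have /cvgrPdist_le /(_ e e0) [n _ nP] : (GRing.exp g @ \oo --> 0)%classic.
  by apply: cvg_expr; rewrite gtr0_norm.
exists n; have := nP n (leqnn n); rewrite /= sub0r normrN.
by apply: le_trans; exact: ler_norm.
Qed.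

(* [z] is the argument of the logarithm in the sample size, with [H = 1 / (1 - g)], and [J]
   counts the test functions of one anchor pair. *)
Lemma failure_probability (R : realType) (K J : nat) (C H delta z : R) :
  388 < C -> (0 < K)%N -> 1 <= H -> 0 < delta < 1 -> J%:R <= 388 * H ^+ 3 ->
  z = C * K%:R * H / delta ->
  K%:R * J%:R * expR (- (3 * ln z)) < delta.
Proof.
move=> C388 K0 H1 /andP[d0 d1] JH zE.
have K1 : (1 : R) <= K%:R by rewrite ler1n.
have C0 : 0 < C by lra.
have z0 : 0 < z by rewrite zE; apply: divr_gt0 => //; rewrite !mulr_gt0 //; lra.
have -> : expR (- (3 * ln z)) = (z ^+ 3)^-1.
  by rewrite expRN exp.expRM_natl lnK // posrE.
rewrite ltr_pdivrMr ?exprn_gt0 //.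
apply: (@le_lt_trans _ _ (K%:R * (388 * H ^+ 3))); first by rewrite ler_pM2l //; lra.
have dz : delta * z = C * K%:R * H by rewrite zE mulrC divfK // gt_eqF.
have zH : H <= z.
  have KH : 0 < K%:R * H by apply: mulr_gt0; lra.
  have : 1 * (K%:R * H) <= C * (K%:R * H) by rewrite ler_pM2r //; lra.
  rewrite zE ler_pdivlMr //.
  have : H * delta <= H * 1 by apply: ler_wpM2l; lra.
  have : H * 1 <= H * K%:R by apply: ler_wpM2l; lra.
  lra.
(* One factor of [z] cancels [delta] and supplies [K]; the other two supply [H ^+ 2]. *)
have -> : delta * z ^+ 3 = C * K%:R * H * z ^+ 2 by rewrite -dz; ring.
have zH2 : H ^+ 2 <= z ^+ 2 by rewrite ler_sqr ?nnegrE //; lra.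
have KH : 0 < K%:R * H by apply: mulr_gt0; lra.
apply: (@lt_le_trans _ _ (C * (K%:R * H * H ^+ 2))); last first.
  have -> : C * K%:R * H * z ^+ 2 = C * (K%:R * H * z ^+ 2) by ring.
  by rewrite ler_pM2l // ler_pM2l.
have q0 : 0 < K%:R * H * H ^+ 2 by apply: mulr_gt0 => //; apply: exprn_gt0; lra.
rewrite [X in X < _](_ : _ = 388 * (K%:R * H * H ^+ 2)); last by ring.
by rewrite ltr_pM2r.
Qed.

Lemma plug_in_sample_complexity (R : realType) (S A : finType) (K N : nat)
    (P : S -> A -> S -> R) (r : S -> A -> R) (g : R) (phi : S -> A -> 'I_K -> R)
    (sk : 'I_K -> S) (ak : 'I_K -> A) (lam : S -> A -> 'I_K -> R)
    (C delta eps e : R) (pihat : outcome S K N -> {ffun S -> A}) :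
  2304 <= C ->
  is_kernel P -> (forall s a, 0 <= r s a <= 1) -> 0 < g < 1 ->
  linear_rep P phi -> anchor phi sk ak lam ->
  0 < delta < 1 -> 0 < eps -> eps * (1 - g) <= 1 -> 0 <= e ->
  (forall w s, Vpi (Phat lam w) r g (pihat w) s >= Vstar (Phat lam w) r g s - e) ->
  N%:R >= C * ln (C * K%:R / ((1 - g) * delta)) / ((1 - g) ^+ 3 * eps ^+ 2) ->
  prob_event P sk ak [pred w | [forall s, forall a,
    Qpi P r g (pihat w) s a >= Qstar P r g s a - eps - 3 * e / (1 - g)]] > 1 - delta.
Proof.
move=> C_ge kerP r01 g01 [psi Ppsi] [lam0 [lam1 philam]] delta01 eps0 eps1 e0 opt.
have /andP[g0 g1] := g01; have /andP[d0 d1] := delta01.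
set H := (1 - g)^-1; set z := _ * K%:R / _ => Nbig.
(* Without a state-action pair the event is everything; otherwise [a0] serves as default action. *)
case: (pselect (exists (s : S) (a : A), True)) => [[s0 [a0 _]]|empty]; last first.
  rewrite /prob_event (eq_bigl xpredT) ?sum_prob_outcome //; first by lra.
  by move=> w /=; apply/forallP => s; apply/forallP => a; exfalso; apply: empty; exists s, a.
have lam_dist s a : is_dist (lam s a) by split.
have P_mix s a : P s a = fun s' => \sum_k lam s a k * P (sk k) (ak k) s'.
  apply/funext => s'; rewrite Ppsi; under eq_bigr do rewrite philam mulr_suml.
  rewrite exchange_big; apply: eq_bigr => k _; rewrite Ppsi mulr_sumr.
  by apply: eq_bigr => i _; rewrite mulrA.
have K0 : (0 < K)%N.
  rewrite lt0n; apply/eqP => K0; have := lam1 s0 a0.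
  by subst K; rewrite big_ord0 => /eqP; rewrite eq_sym oner_eq0.
have h0 : 0 < 1 - g by lra.
have hH : (1 - g) * H = 1 by rewrite mulfV // gt_eqF.
have H1 : 1 <= H by rewrite invf_ge1; lra.
have H0 : 0 < H by lra.
have C0 : 0 < C by lra.
have zE : z = C * K%:R * H / delta.
  by rewrite /z /H invfM mulrA.
have K1 : (1 : R) <= K%:R by rewrite ler1n.
(* The logarithm is then positive, so the bound on the sample size forces [N > 0]. *)
have z1 : 1 < z.
  rewrite zE ltr_pdivlMr // mul1r.
  have KH : 1 <= K%:R * H by rewrite -[leLHS]mul1r; apply: ler_pM.
  have : C * 1 <= C * (K%:R * H) by rewrite ler_pM2l.
  lra.
have lnz : 0 < ln z by exact: ln_gt0.
have den : 0 < (1 - g) ^+ 3 * eps ^+ 2 by apply: mulr_gt0; exact: exprn_gt0.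
have NR : (0 : R) < N%:R.
  by apply: lt_le_trans Nbig; apply: divr_gt0 => //; apply: mulr_gt0.
have N0 : (0 < N)%N by rewrite ltr0n in NR.
rewrite ler_pdivrMr // in Nbig.
pose x := eps * (1 - g) ^+ 2 / 16; pose eta := eps * (1 - g) ^+ 2 / 96.
pose L := 3 * ln z; pose y := L / (N%:R * (x / 8)).
have xH : x * H = eps * (1 - g) / 16.
  by rewrite -[RHS]mulr1 -[X in _ = _ * X]hH /x; ring.
have etaH : eta * H = eps * (1 - g) / 96.
  by rewrite -[RHS]mulr1 -[X in _ = _ * X]hH /eta; ring.
have eh0 : 0 < eps * (1 - g) by exact: mulr_gt0.
have x0 : 0 < x by rewrite -(pmulr_lgt0 _ H0) xH; lra.
have L0 : 0 < L by rewrite /L; lra.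
have Nx0 : 0 < N%:R * (x / 8) by apply: mulr_gt0 => //; lra.
have y0 : 0 <= y by rewrite /y; apply: divr_ge0; exact: ltW.
(* The threshold is [2304 = 6 * 3 * 128], with 3 from [L] and [128 = 16 * 8] from [x / 8]. *)
have y1 : 6 * y <= eps * (1 - g).
  rewrite /y mulrA ler_pdivrMr //.
  have -> : eps * (1 - g) * (N%:R * (x / 8)) = N%:R * ((1 - g) ^+ 3 * eps ^+ 2) / 128.
    by rewrite /x; field.
  rewrite /L; have : 2304 * ln z <= C * ln z by rewrite ler_pM2r.
  lra.
(* The number of iterations changes neither the count of test functions nor their bound, so it may
   be arbitrarily large. *)
have [n gn] : exists n, g ^+ n <= eps * (1 - g) / 96 / H.
  by apply: expn_small => //; apply: divr_gt0 => //; lra.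
have gnH : g ^+ n * H <= eps * (1 - g) / 96 by rewrite -ler_pdivlMr.
apply: (bernstein_uniform kerP N0 (F := @test_function R S A K N P r g sk ak lam eps x eta n)
  (B := 2 * H) (x := x / 8) (L := L)).
- by move=> k j w v; exact: test_function_resample.
- by move=> k j w s; apply: test_function_bound.
- by lra.
- by rewrite mulrCA mulrAC; lra.
- have H3 : 1 <= H ^+ 3 by rewrite exprn_ege1.
  apply: (failure_probability (C := C) _ K0 H1 delta01 _ zE); first by lra.
  (* At most [384 * H ^+ 3 + 1] grid functions and three others; [1 <= H ^+ 3] absorbs the 4. *)
  rewrite !card_option card_ord -addn3 natrD.
  have := natr_ceil_bound (z := 384 * H ^+ 3); lra.
move=> w dev; apply/forallP => s; apply/forallP => a.
rewrite -[3 * e / _]/(3 * e * H).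
exact: (good_event N0 kerP r01 g01 lam_dist P_mix a0 eps0 eps1 xH etaH y0 y1 e0 (opt w) gnH dev).
Qed.

Theorem theorem1 :
  exists c : Rdefinitions.R, 0 < c /\
  forall (S A : finType) (K : nat)
    (P : S -> A -> S -> Rdefinitions.R) (r : S -> A -> Rdefinitions.R)
    (g : Rdefinitions.R)
    (phi : S -> A -> 'I_K -> Rdefinitions.R)
    (sk : 'I_K -> S) (ak : 'I_K -> A)
    (lam : S -> A -> 'I_K -> Rdefinitions.R)
    (delta eps epsPS : Rdefinitions.R) (N : nat)
    (pihat : outcome S K N -> {ffun S -> A}),
    is_kernel P ->
    (forall s a, 0 <= r s a <= 1) ->
    0 < g < 1 ->
    linear_rep P phi ->
    anchor phi sk ak lam ->
    0 < delta < 1 ->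
    0 < eps <= (Num.sqrt (1 - g))^-1 ->
    0 <= epsPS ->
    (forall w s, Vpi (Phat lam w) r g (pihat w) s >= Vstar (Phat lam w) r g s - epsPS) ->
    N%:R >= c * ln (c * K%:R / ((1 - g) * delta)) / ((1 - g) ^+ 3 * eps ^+ 2) ->
    prob_event P sk ak
      [pred w | [forall s, forall a,
         Qpi P r g (pihat w) s a >= Qstar P r g s a - eps - 3 * epsPS / (1 - g)]]
    > 1 - delta.
Proof.
exists 4000; split; first by rewrite ltr0n.
move=> S A K P r g phi sk ak lam delta eps epsPS N pihat kerP r01 g01 linP anch d01.
move=> /andP[eps0 epsH] e0 opt Nbig.
(* Split [1 - g] into two square roots: [eps] times the first is at most 1, and so is the second. *)
have eps1 : eps * (1 - g) <= 1.
  have h0 : 0 < 1 - g by have /andP[] := g01; lra.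
  have h1 : 1 - g <= 1 by have /andP[] := g01; lra.
  have q0 : 0 < Num.sqrt (1 - g) by rewrite sqrtr_gt0.
  have q1 : Num.sqrt (1 - g) <= 1 by rewrite -[leRHS]sqrtr1 ler_wsqrtr.
  rewrite -{1}(sqr_sqrtr (ltW h0)) expr2 mulrA -[leRHS]mulr1.
  apply: ler_pM => //; rewrite ?mulr_ge0 // ?(ltW eps0) ?(ltW q0) //.
  by rewrite -ler_pdivlMr // mul1r.
have C_ge : 2304 <= 4000 :> Rdefinitions.R by rewrite ler_nat.
exact: (plug_in_sample_complexity C_ge kerP r01 g01 linP anch d01 eps0 eps1 e0 opt Nbig).
Qed.
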